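(* Let $G$ be a finite group, and let $A$ and $B$ be subnormal supersoluble subgroups of $G$ such that $G=\langle A,B\rangle$. If the derived subgroup $G'$ of $G$ is nilpotent, then $G$ is supersoluble.
   Context: All groups are finite. $\langle A,B\rangle$ denotes the subgroup generated by $A$ and $B$ (it need not equal the product set $AB$). A subgroup $H$ of $G$ is subnormal if there is a chain $H=H_0\trianglelefteq H_1\trianglelefteq\dots\trianglelefteq H_n=G$. A finite group is supersoluble if it has a series of normal subgroups of the whole group, from $1$ to the whole group, with all factors cyclic. The derived subgroup $G'$ is the commutator subgroup of $G$. *)

(* Defs.v *)
From mathcomp Require Import all_boot all_fingroup all_solvable.

Set Implicit Arguments.
Unset Strict Implicit.
Unset Printing Implicit Defensive.

Local Open Scope group_scope.

(* Both terms are required to be normal in the whole group [G], not merely    *)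
(* the smaller one in the larger; the latter would only give solvability.      *)
Definition cyclic_factor (gT : finGroupType) (G V U : {set gT}) : bool :=
  [&& V \subset U, V <| G, U <| G & cyclic (U / V)].

(* The series is 1 :: s. When s is empty there is no factor, and G = 1.       *)
Definition supersoluble (gT : finGroupType) (G : {group gT}) : Prop :=
  exists2 s : seq {group gT},
    (cyclic_factor G).-series 1%G s & last 1%G s :=: G.

(* Main.v *)
(* By induction it is enough to show that a minimal normal subgroup N of G, an
   elementary abelian p-group, is cyclic. The nilpotent group G' centralises N,
   so G acts on N as an irreducible abelian group. Each element of A or B acts
   on N with exponent dividing p - 1, hence so does each element of G; as F_p
   contains the (p - 1)-th roots of unity, G acts by scalars, so every cyclic
   subgroup of N is normal in G. *)
Require Import Defs.
From mathcomp Require Import all_boot all_fingroup all_solvable.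
From mathcomp Require Import all_algebra finfield mxrepresentation mxabelem.

Local Open Scope group_scope.

(** * Series with cyclic factors under quotients and extensions *)

(** An equation between subgroups is easy to carry through images and preimages under [coset N],
    with no isomorphism between iterated quotients. *)
Lemma cyclic_quotientP (gT : finGroupType) (U V : {group gT}) : V <| U ->
  reflect (exists2 x, x \in U & U :=: V <*> <[x]>) (cyclic (U / V)).
Proof.
move=> nsVU; have [sVU nVU] := andP nsVU.
apply: (iffP cyclicP) => [[xb defUV]|[x Ux defU]]; last first.
  exists (coset V x); have Nx := subsetP nVU x Ux.
  by rewrite {1}defU quotientYidl ?cycle_subG // quotient_cycle.
have: xb \in U / V by rewrite defUV cycle_id.
case/morphimP=> x Nx Ux def_x; exists x => //.
rewrite -quotientYK ?cycle_subG // quotient_cycle // -def_x -defUV.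
by rewrite quotientGK.
Qed.

Lemma cyclic_factor_quotient {gT : finGroupType} {G V U N : {group gT}} :
  G \subset 'N(N) -> cyclic_factor G V U ->
  cyclic_factor (G / N) (V / N) (U / N).
Proof.
move=> nNG /and4P[sVU nsVG nsUG cycUV].
have nsVU : V <| U by rewrite (normalS sVU (normal_sub nsUG)).
have nNU := subset_trans (normal_sub nsUG) nNG.
apply/and4P; split; rewrite ?quotientS ?quotient_normal //.
apply/cyclic_quotientP; first exact: quotient_normal.
have [x Ux defU] := cyclic_quotientP _ _ _ nsVU cycUV.
have Nx := subsetP nNU x Ux.
exists (coset N x); first exact: mem_quotient.
rewrite /= {1}defU quotientY ?quotient_cycle ?cycle_subG //.
exact: subset_trans sVU nNU.
Qed.

Lemma cyclic_factor_cosetpre {gT : finGroupType} {G N : {group gT}}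
    {V U : {group coset_of N}} :
  N <| G -> cyclic_factor (G / N) V U ->
  cyclic_factor G (coset N @*^-1 V) (coset N @*^-1 U).
Proof.
move=> nsNG /and4P[sVU nsVG nsUG cycUV].
have nsVU : V <| U by rewrite (normalS sVU (normal_sub nsUG)).
have nsV'U' : coset N @*^-1 V <| coset N @*^-1 U by rewrite cosetpre_normal.
apply/and4P; split; rewrite ?(normal_sub nsV'U') //.
- by rewrite -(quotientGK nsNG) cosetpre_normal.
- by rewrite -(quotientGK nsNG) cosetpre_normal.
apply/(cyclic_quotientP _ _ _ nsV'U').
have [xb Uxb defU] := cyclic_quotientP _ _ _ nsVU cycUV.
have [x Nx def_x] := cosetP xb.
exists x; first by rewrite mem_morphpre /= -?def_x.
have sY : V <*> <[xb]> = (coset N @*^-1 V <*> <[x]>) / N.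
  by rewrite quotientY ?cycle_subG ?subsetIl // cosetpreK quotient_cycle ?def_x.
rewrite /= {1}defU sY quotientGK // /normal join_subG subsetIl cycle_subG Nx.
by rewrite !andbT; exact: subset_trans (sub_cosetpre _) (joing_subl _ _).
Qed.

(** [N] is only normalised by [G]: the lemma serves for the subnormal subgroups [A] and [B], which
    may fail to contain [N]. *)
Lemma supersoluble_quotient {gT : finGroupType} {G N : {group gT}} :
  G \subset 'N(N) -> supersoluble G -> supersoluble (G / N).
Proof.
move=> nNG [s ser_s last_s]; pose f (H : {group gT}) := (H / N)%G.
have f1 : f 1%G = 1%G by apply: group_inj; rewrite /= quotient1.
exists (map f s); rewrite -f1; last by rewrite last_map /= last_s.
rewrite path_map; apply: sub_path ser_s => V U /=.
exact: cyclic_factor_quotient.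
Qed.

Lemma supersoluble_cyclic_ext {gT : finGroupType} {G N : {group gT}} :
  N <| G -> cyclic N -> supersoluble (G / N) -> supersoluble G.
Proof.
move=> nsNG cycN [s ser_s last_s].
pose f (H : {group coset_of N}) := (coset N @*^-1 H)%G.
(* The lifted series starts at [N], so the cyclic factor from [1] to [N] is put in front. *)
have f1 : f 1%G = N by apply: group_inj; rewrite /= -kerE ker_coset.
exists (N :: map f s); last first.
  by rewrite /= -{1}f1 last_map /= last_s quotientGK.
rewrite /= -{2}f1 path_map; apply/andP; split.
  by rewrite /cyclic_factor sub1G normal1 nsNG quotient_cyclic.
by apply: sub_path ser_s => V U /=; apply: cyclic_factor_cosetpre.
Qed.

(** Take the first term [U] of the series that meets [N] nontrivially, and its predecessor [V]. Then
    [N :&: U] embeds in the cyclic group [U / V], and a nontrivial cyclic elementary abelian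
    [p]-group has order [p]. *)
Lemma supersoluble_normal_prime {gT : finGroupType} {G N : {group gT}}
    {p : nat} :
    supersoluble G -> N <| G -> N :!=: 1 -> p.-abelem N ->
  exists Q : {group gT}, [/\ Q \subset N, Q <| G, cyclic Q & #|Q| = p].
Proof.
move=> [s]; have : N :&: 1%G = 1 by apply/trivgP; apply: subsetIr.
elim: s 1%G => [|U s IHs] V /= tiNV;
  [move=> _ defG | move=> /andP[cf ser_s] lastG] => nsNG ntN abelN.
  by case/eqP: ntN; rewrite -(setIidPl (normal_sub nsNG)) -defG.
have [tiNU | ntNU] := eqVneq (N :&: U) 1; first exact: (IHs U).
have /and4P[sVU nsVG nsUG cycUV] := cf.
have nVN : N :&: U \subset 'N(V).
  have nVN := subset_trans (normal_sub nsNG) (normal_norm nsVG).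
  exact: subset_trans (subsetIl _ _) nVN.
have abelQ : p.-abelem (N :&: U) := abelemS (subsetIl _ _) abelN.
have tiVQ : V :&: (N :&: U) = 1.
  by apply/trivgP; rewrite /= -tiNV setIA (setIC V) subsetIl.
have cycQ : cyclic (N :&: U).
  rewrite (isog_cyclic (quotient_isog nVN tiVQ)).
  by apply: cyclicS cycUV; rewrite quotientS ?subsetIr.
exists (N :&: U)%G; split; rewrite ?subsetIl ?normalI //=.
have pQ := abelem_pgroup abelQ.
have [p_pr _ [n oQ]] := pgroup_pdiv pQ ntNU.
move: (cycQ); rewrite (abelem_cyclic abelQ) {1}oQ pfactorK //.
by rewrite ltnS leqn0 => /eqP n0; rewrite /= oQ n0 expn1.
Qed.

(** * Subnormal and minimal normal subgroups *)

(** If [A] is subnormal in a proper normal subgroup [K] of [G], then [[~: N, A]] lies in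
    [[~: G, K]], hence in [K]; so [N] does too, and [K] replaces [G]. *)
Lemma subnormal_sub_commg {gT : finGroupType} {G A N : {group gT}} :
  A <|<| G -> N \subset G -> N \subset [~: N, A] -> N \subset A.
Proof.
move: {2}_.+1 (ltnSn #|G|) => n; elim: n => // n IHn in G *.
rewrite ltnS => leGn snA sNG sNNA.
have [-> // | [K [snAK nsKG prKG]]] := subnormalEr snA.
apply: (IHn K) => //; first exact: leq_trans (proper_card prKG) leGn.
apply: subset_trans sNNA (subset_trans (commgSS sNG (subnormal_sub snAK)) _).
by rewrite commg_subr normal_norm.
Qed.

Lemma minnormal_sub_norm {gT : finGroupType} {G N K : {group gT}} :
  minnormal N G -> K \subset N -> G \subset 'N(K) -> K :!=: 1 -> K :=: N.
Proof.
case/mingroupP=> _ minN sKN nKG ntK; apply: minN; rewrite ?ntK //.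
Qed.

(** If [N :&: K] is trivial, so is the commutator of [N] and [K]. Otherwise minimality puts [N] in
    [K]; there it meets ['Z(K)] nontrivially, and minimality puts it in ['Z(K)]. *)
Lemma minnormal_cent_nilpotent {gT : finGroupType} {G N K : {group gT}} :
  minnormal N G -> N \subset G -> K <| G -> nilpotent K -> K \subset 'C(N).
Proof.
move=> minN sNG nsKG nilK; have [/andP[ntN nNG] _] := mingroupP minN.
have nsNG : N <| G by apply/andP.
have [sKG nKG] := andP nsKG.
have [tiNK | ntNK] := eqVneq (N :&: K) 1.
  rewrite centsC; apply/commG1P/trivgP; rewrite -tiNK subsetI.
  by rewrite commg_subl commg_subr (subset_trans sKG) ?(subset_trans sNG).
have defNK := minnormal_sub_norm minN (subsetIl N K) (normsI nNG nKG) ntNK.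
have sNK : N \subset K by rewrite -defNK subsetIr.
have ntNZ := meet_center_nil nilK (normalS sNK sKG nsNG) ntN.
have nZG : G \subset 'N(N :&: 'Z(K)) := normsI nNG (gFnorm_trans _ nKG).
rewrite centsC -(minnormal_sub_norm minN (subsetIl _ _) nZG ntNZ).
by rewrite /= /center setIA subsetIr.
Qed.

(* Since [G] acts on [N] as an abelian group, each eigenspace of [g] is
   [G]-invariant, hence all of [N] once it is nontrivial. *)
Lemma minnormal_pow_conj {gT : finGroupType} {G N : {group gT}} {g v : gT}
    {k : nat} :
    minnormal N G -> abelian N -> G^`(1) \subset 'C(N) ->
    g \in G -> v \in N -> v != 1 -> v ^ g = v ^+ k ->
  {in N, forall w, w ^ g = w ^+ k}.
Proof.
move=> minN abN cG'N Gg Nv ntv vg; have [/andP[ntN nNG] _] := mingroupP minN.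
pose E := [set w in N | w ^ g == w ^+ k].
have gE : group_set E.
  apply/group_setP; split=> [|x y].
    by rewrite inE group1 conj1g expg1n /=.
  rewrite !inE => /andP[Nx /eqP xg] /andP[Ny /eqP yg].
  by rewrite groupM //= conjMg xg yg expgMn //; apply: (centsP abN).
have nEG : G \subset 'N(Group gE).
  apply/subsetP=> h Gh; rewrite inE; apply/subsetP=> _ /imsetP[w Ew ->].
  move: Ew; rewrite /= !inE => /andP[Nw /eqP wg].
  have Nwh : w ^ h \in N by rewrite memJ_norm ?(subsetP nNG).
  have c : [~ h, g] \in 'C(N) by rewrite (subsetP cG'N) ?mem_commg.
  have Nwgh : w ^ (g * h) \in N by rewrite memJ_norm ?groupM ?(subsetP nNG).
  (* [h * g] and [g * h] differ by [[~ h, g]], which acts trivially on [N]. *)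
  rewrite Nwh /= -conjgM [h * g]commgC (conjgM w (g * h)).
  by rewrite [X in X == _]conjgE -(centP c _ Nwgh) mulKg conjgM wg conjXg.
have defE : E = N.
  apply: (minnormal_sub_norm (K := Group gE) minN _ nEG).
    by apply/subsetP=> w; rewrite inE; case/andP.
  by apply/trivgPn; exists v; rewrite // inE Nv vg /=.
by move=> w; rewrite -defE inE => /andP[_ /eqP].
Qed.

(** * Exponent [p.-1] and scalar action *)

Lemma abelem_eigenvector {gT : finGroupType} {E : {group gT}} {p : nat}
    {g : gT} :
    p.-abelem E -> E :!=: 1 -> g \in 'N(E) -> g ^+ p.-1 \in 'C(E) ->
  exists v k, [/\ v \in E, v != 1 & v ^ g = v ^+ k].
Proof.
move=> abelE ntE nEg cEg.
have [p_pr _ _] := pgroup_pdiv (abelem_pgroup abelE) ntE.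
have nEG : <[g]> \subset 'N(E) by rewrite cycle_subG.
pose rG := abelem_repr abelE ntE nEG; pose A := rG g.
have Ap : (A ^+ p = A)%R.
  rewrite -repr_mxX ?cycle_id //; apply/row_matrixP=> i; rewrite !rowE.
  apply: (rVabelem_inj abelE ntE); rewrite !rVabelemJ ?cycle_id ?mem_cycle //.
  have -> : g ^+ p = g ^+ p.-1 * g by rewrite -expgSr prednK ?prime_gt0.
  rewrite conjgM; congr (_ ^ _).
  by rewrite conjgE -(centP cEg) ?mem_rVabelem ?mulKg.
have minA : (mxminpoly A %| 'X^p - 'X)%R.
  apply: mxminpoly_min.
  by rewrite GRing.rmorphB GRing.rmorphXn /= horner_mx_X Ap GRing.subrr.
have genF : ('X^p - 'X = \prod_(a : 'F_p) ('X - a%:P))%R.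
  by rewrite -finField_genPoly card_Fp.
move: minA; rewrite genF => /dvdp_prod_XsubC[m eqA].
(* The minimal polynomial is a product of some of the ['X - a%:P]; the empty product is excluded
   because it is not constant. *)
have [a ra] : exists a, root (mxminpoly A) a.
  move: eqA; case: (mask _ _) => [|a r] eqA; last first.
    by exists a; rewrite (eqp_root eqA) big_cons rootM root_XsubC eqxx.
  have := mxminpoly_nonconstant A; have := eqp_size eqA.
  by rewrite size_mxminpoly big_nil size_poly1 => -[->].
have /eigenvalueP[v vA nzv] : eigenvalue A a by rewrite eigenvalue_root_min.
(* The eigenvalue in ['F_p], read as a natural number, is the exponent: scaling a row vector is
   taking a power in [E]. *)
exists (rVabelem abelE ntE v), a; split; first exact: mem_rVabelem.
  apply: contraNneq nzv => v1; apply/eqP/(rVabelem_inj abelE ntE).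
  by rewrite rVabelem0.
by rewrite -rVabelemZ -vA rVabelemJ ?cycle_id.
Qed.

(** The order of [Aut Q] is [totient #|Q|], which kills the automorphism induced by [x]. *)
Lemma cyclic_conj_totient {gT : finGroupType} {Q : {group gT}} {x : gT} :
  cyclic Q -> x \in 'N(Q) -> x ^+ totient #|Q| \in 'C(Q).
Proof.
move=> cycQ nQx; apply/centP=> v Qv; apply: commute_sym.
apply/commgP/conjg_fixP.
rewrite -(norm_conj_autE (G := Q)) ?groupX // [conj_aut Q _]morphX //.
have Ax : conj_aut Q x \in Aut Q.
  by rewrite (subsetP (Aut_conj_aut Q 'N(Q))) ?mem_morphim.
by rewrite -card_Aut_cyclic // expg_cardG // perm1.
Qed.

Lemma supersoluble_subnormal_expg_cent {gT : finGroupType}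
    {G A N : {group gT}} {p : nat} {x : gT} :
    minnormal N G -> N \subset G -> p.-abelem N -> G^`(1) \subset 'C(N) ->
    A <|<| G -> supersoluble A -> x \in A -> x ^+ p.-1 \in 'C(N).
Proof.
move=> minN sNG abelN cG'N snA ssA Ax; set y := x ^+ _.
have [/andP[ntN nNG] _] := mingroupP minN.
have [p_pr _ _] := pgroup_pdiv (abelem_pgroup abelN) ntN.
have abN := abelem_abelian abelN; have sAG := subnormal_sub snA.
have Ay : y \in A by rewrite groupX.
have Gy := subsetP sAG y Ay.
(* One nontrivial fixed point suffices: it is an eigenvector with exponent [1]. *)
have cNy v : v \in N -> v != 1 -> v ^ y = v -> y \in 'C(N).
  move=> Nv ntv vy; apply/centP=> w Nw; apply: commute_sym.
  apply/commgP/conjg_fixP.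
  exact: (minnormal_pow_conj (k := 1) minN abN cG'N Gy Nv ntv vy w Nw).
apply: contraT => not_cNy.
(* Now [y - 1] is bijective on [N]: subnormality forces [N] into [A], while a
   normal subgroup of [A] of order [p] inside [N] is centralised by [y]. *)
have inj_y : {in N &, injective (fun v => [~ v, y])}.
  move=> v w Nv Nw /= eq_vw; apply/eqP; rewrite eq_mulgV1.
  apply: contraR not_cNy => nt_vw; apply: (cNy (v * w^-1)) => //.
    by rewrite groupM ?groupV.
  have Nvy : v ^ y \in N by rewrite memJ_norm ?(subsetP nNG).
  have Nwy : w ^ y \in N by rewrite memJ_norm ?(subsetP nNG).
  move: eq_vw; rewrite !commgEl => /(canRL (mulKVg v)) vy.
  by rewrite conjMg conjVg vy mulgA mulgK.
have sNNA : N \subset [~: N, A].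
  (* An injective map from the finite set [N] to itself is onto, so every element of [N] is a
     commutator with [y], which is in [A]. *)
  suffices imN : [set [~ v, y] | v in N] = N.
    rewrite -{1}imN.
    by apply/subsetP=> _ /imsetP[v Nv ->]; rewrite mem_commg.
  apply/eqP; rewrite eqEcard card_in_imset // leqnn andbT.
  apply/subsetP=> _ /imsetP[v Nv ->].
  by rewrite commgEl groupM ?groupV // memJ_norm ?(subsetP nNG).
have sNA := subnormal_sub_commg snA sNG sNNA.
have nsNA : N <| A by rewrite /normal sNA (subset_trans sAG).
have [Q [sQN nsQA cycQ oQ]] := supersoluble_normal_prime ssA nsNA ntN abelN.
have /trivgPn[v Qv ntv] : Q :!=: 1 by rewrite -cardG_gt1 oQ prime_gt1.
case/negP: not_cNy; apply: (cNy v) => //; first exact: (subsetP sQN).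
apply/conjg_fixP/commgP; apply: commute_sym.
have := cyclic_conj_totient cycQ (subsetP (normal_norm nsQA) x Ax).
by rewrite oQ totient_prime // => /centP; apply.
Qed.

(* For each [g] in [G], [X^p - X] kills the action of [g] on [N] and splits over
   [F_p], so [g] has an eigenvector and hence acts as a scalar. *)
Lemma minnormal_cyclic {gT : finGroupType} {G A B N : {group gT}} :
    A <|<| G -> B <|<| G -> supersoluble A -> supersoluble B ->
    G :=: A <*> B -> nilpotent G^`(1) -> minnormal N G -> N \subset G ->
  cyclic N.
Proof.
move=> snA snB ssA ssB defG nilG' minN sNG.
have solG : solvable G.
  rewrite (series_sol (der_normal 1 G)) nilpotent_sol //.
  by rewrite abelian_sol ?der_abelian.
have [nNG ntN /is_abelemP[p p_pr abelN]] := minnormal_solvable minN sNG solG.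
have abN := abelem_abelian abelN.
have cG'N := minnormal_cent_nilpotent minN sNG (der_normal 1 G) nilG'.
have expX x : x \in G -> x ^+ p.-1 \in 'C(N).
  (* [G / 'C(N)] is abelian, so the [p.-1]-th power is multiplicative modulo ['C(N)] and [E] is a
     subgroup; it contains [A] and [B]. *)
  pose E := [set x in G | x ^+ p.-1 \in 'C(N)].
  have gE : group_set E.
    apply/group_setP; split=> [|u v]; first by rewrite inE group1 expg1n group1.
    rewrite !inE => /andP[Gu cu] /andP[Gv cv]; rewrite groupM //=.
    have nCG : G \subset 'N('C(N)) := norms_cent nNG.
    have [nCu nCv] := (subsetP nCG u Gu, subsetP nCG v Gv).
    have abGC : abelian (G / 'C(N)) by rewrite sub_der1_abelian.
    apply: coset_idr; first by rewrite groupX ?groupM.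
    rewrite morphX ?groupM //= morphM // expgMn; last first.
      by apply: (centsP abGC); rewrite mem_quotient.
    by rewrite -!morphX //= !coset_id // mulg1.
  have sGE : G \subset Group gE.
    rewrite defG join_subG.
    apply/andP; split; apply/subsetP=> y Xy; rewrite inE.
      rewrite (subsetP (subnormal_sub snA)) //.
      exact: (supersoluble_subnormal_expg_cent minN sNG abelN cG'N snA ssA Xy).
    rewrite (subsetP (subnormal_sub snB)) //.
    exact: (supersoluble_subnormal_expg_cent minN sNG abelN cG'N snB ssB Xy).
  by move/(subsetP sGE); rewrite inE => /andP[].
have [v Nv ntv] := trivgPn _ ntN.
apply/cyclicP; exists v; apply/esym.
apply: (minnormal_sub_norm (K := <[v]>) minN);
  rewrite ?cycle_subG ?cycle_eq1 //.
apply/subsetP=> g Gg.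
have cg := expX g Gg.
have [w [k [Nw ntw wg]]] := abelem_eigenvector abelN ntN (subsetP nNG g Gg) cg.
have powg := minnormal_pow_conj minN abN cG'N Gg Nw ntw wg.
by rewrite inE -cycleJ cycle_subG powg // mem_cycle.
Qed.

Theorem corollary1p1p1 (gT : finGroupType) (G A B : {group gT})
    (snA : A <|<| G) (snB : B <|<| G)
    (ssA : supersoluble A) (ssB : supersoluble B)
    (defG : G :=: A <*> B)
    (nilG' : nilpotent G^`(1)) :
  supersoluble G.
Proof.
(* Induction on the order of [G], with [gT] generalised because [G / N] lives in another group
   type. *)
move: {2}_.+1 (ltnSn #|G|) => n.
elim: n => // n IHn in gT G A B snA snB ssA ssB defG nilG' *.
rewrite ltnS => leGn.
have [G1 | ntG] := eqVneq (gval G) 1; first by exists [::].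
have [N minN sNG] := minnormal_exists ntG (normG G).
have [/andP[ntN nNG] _] := mingroupP minN.
have nNX (X : {group gT}) : X <|<| G -> X \subset 'N(N).
  by move=> snX; apply: subset_trans (subnormal_sub snX) nNG.
have cycN := minnormal_cyclic snA snB ssA ssB defG nilG' minN sNG.
apply: (supersoluble_cyclic_ext _ cycN); first exact/andP.
apply: (IHn _ _ (A / N)%G (B / N)%G); rewrite ?quotient_subnormal //.
- exact: supersoluble_quotient (nNX _ snA) ssA.
- exact: supersoluble_quotient (nNX _ snB) ssB.
- by rewrite /= {1}defG quotientY ?nNX.
- by rewrite /= -quotient_der ?quotient_nil.
- exact: leq_trans (ltn_quotient ntN sNG) leGn.
Qed.
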